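(* Let $X(\boldsymbol{s})$ be a stationary, mean-square differentiable Gaussian random field on $\mathcal{D}\subset\mathbb{R}^2$ with short-ranged covariance function $c(\boldsymbol{r})$ whose spectral density satisfies $\tilde{C}(\boldsymbol{k})=\mathcal{O}(\|\boldsymbol{k}\|^{-3-\epsilon})$ for some $\epsilon>0$ as $\|\boldsymbol{k}\|\to\infty$, with anisotropy parameters $(R^\ast,\theta^\ast)$, sampled at $N$ points. Then, for $R>0$, the non-parametric approximation $f^{(0)}_{\hat{R},\hat{\theta}}(R,\theta;R^\ast,\theta^\ast,N)$ of the joint density of the anisotropy statistics $(\hat{R},\hat{\theta})$ is given in the asymptotic regime by $$ f^{(0)}_{\hat{R},\hat{\theta}}(R,\theta;R^\ast,\theta^\ast,N)=\frac{2R\,|R^2-1|}{(R^2\cos^2\theta+\sin^2\theta)^3}\; f^{(0)}_{\hat{\boldsymbol{q}}}(R,\theta;R^\ast,\theta^\ast,N), $$ where, to leading order as $N\to\infty$ (ratio of the two sides tending to $1$), $$ f^{(0)}_{\hat{\boldsymbol{q}}}(R,\theta;R^\ast,\theta^\ast,N)\approx\frac{\sqrt{2\pi}\,\lambda_{2;0}}{z_{1;0}^{3}}\,(2y_0^2N+1)\,e^{N(y_0^2-1/2)} . $$ The coefficients are, with $\delta\theta=\theta-\theta^\ast$ and $z_{1;0}>0$, $$ y_0=\frac{1}{\sqrt{2}\,z_{1;0}}\Big[(R^2-1)(R^{\ast2}-1)\cos(2\delta\theta)-(R^2+1)(R^{\ast2}+1)\Big], $$ $$ \lambda_{2;0}=\frac{\sqrt{2}\,(R^\ast)^3}{\pi^{3/2}}\Big[(R^2+1)+(R^2-1)\cos(2\theta)\Big]^3,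 $$ $$ z_{1;0}^2=(R^2-1)^2(R^{\ast2}-1)^2\cos(4\delta\theta)-4(R^4-1)(R^{\ast4}-1)\cos(2\delta\theta)+(R^4+1)(3R^{\ast4}+2R^{\ast2}+3)+2R^2(R^{\ast2}-1)^2 . $$
   Context: Setting. $X(\boldsymbol{s})$ is a wide-sense stationary Gaussian random field on $\mathcal D\subset\mathbb{R}^2$ with constant mean, covariance function $c(\boldsymbol{r})$, first-order differentiable in the mean-square sense. Short-ranged means $\int d\boldsymbol{r}\,|c(\boldsymbol{r})|<\infty$; $\tilde{C}$ is the Fourier transform of $c$, and the decay condition means $\tilde C(\boldsymbol{k})\le C_\infty/\|\boldsymbol{k}\|^{3+\epsilon}$ for some $\epsilon,C_\infty>0$ and all large $\|\boldsymbol{k}\|$. Let $Q^\ast_{ij}=\mathbb{E}[\partial_iX\,\partial_jX]$ and write $\boldsymbol{Q}^\ast=(Q^\ast_{11},Q^\ast_{22},Q^\ast_{12})^t$. The anisotropy parameters $R^\ast\in(0,\infty)$ (ratio $\xi_2/\xi_1$ of principal correlation lengths) and $\theta^\ast\in[-\pi/4,\pi/4)$ (orientation angle) satisfy $$\frac{Q^\ast_{22}}{Q^\ast_{11}}=\frac{1+R^{\ast2}\tan^2\theta^\ast}{R^{\ast2}+\tan^2\theta^\ast},\qquad \frac{Q^\ast_{12}}{Q^\ast_{11}}=\frac{\tan\theta^\ast(R^{\ast2}-1)}{R^{\ast2}+\tan^2\theta^\ast}.$$ The anisotropy statistics $(\hat R,\hat\theta)$ are obtained from these same relations with $Q^\ast_{ij}$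 replaced by the sample averages $\hat Q_{ij}=\frac1N\sum_{k=1}^N\partial_iX(\boldsymbol{s}_k)\partial_jX(\boldsymbol{s}_k)$ over the sampling locations $\boldsymbol{s}_k$. Non-parametric approximation. Put $$\boldsymbol{C}^{(0)}=\frac{2}{N}\begin{bmatrix} Q_{11}^{\ast2}&Q_{12}^{\ast2}&Q^\ast_{11}Q^\ast_{12}\\ Q_{12}^{\ast2}&Q_{22}^{\ast2}&Q^\ast_{12}Q^\ast_{22}\\ Q^\ast_{11}Q^\ast_{12}&Q^\ast_{12}Q^\ast_{22}&\tfrac12(Q_{12}^{\ast2}+Q^\ast_{11}Q^\ast_{22})\end{bmatrix},$$ which replaces the exact covariance matrix of $\hat{\mathbb{Q}}=(\hat Q_{11},\hat Q_{22},\hat Q_{12})^t$. For $R>0$, $\theta\in[-\pi/4,\pi/4)$ set $q_{\mathrm d}=\frac{1+R^2\tan^2\theta}{R^2+\tan^2\theta}$, $q_{\mathrm o}=\frac{\tan\theta(R^2-1)}{R^2+\tan^2\theta}$, $\boldsymbol{q}'=(1,q_{\mathrm d},q_{\mathrm o})^t$. The function $f^{(0)}_{\hat{\boldsymbol q}}$ is the density of the ratios $(\hat Q_{22}/\hat Q_{11},\hat Q_{12}/\hat Q_{11})$ obtained in the asymptotic (Central Limit Theorem) regime with this covariance matrix: $$ f^{(0)}_{\hat{\boldsymbol q}}=\frac{\lambda_2e^{-\lambda_1/2}}{8z_1^5}\Big[\sqrt{2\pi}\,(z_2^2+4z_1^2)\exp\Big(\frac{z_2^2}{8z_1^2}\Big)\operatorname{erfc}\Big(\frac{z_2}{2\sqrt2\,z_1}\Big)-4z_1z_2\Big],$$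 where $z_1>0$, $z_1^2=\boldsymbol{q}'^t(\boldsymbol{C}^{(0)})^{-1}\boldsymbol{q}'$, $z_2=-2\boldsymbol{Q}^{\ast t}(\boldsymbol{C}^{(0)})^{-1}\boldsymbol{q}'$, $\lambda_1=\boldsymbol{Q}^{\ast t}(\boldsymbol{C}^{(0)})^{-1}\boldsymbol{Q}^\ast$, $\lambda_2=(2\pi)^{-3/2}[\det\boldsymbol{C}^{(0)}]^{-1/2}$, and $\operatorname{erfc}$ is the complementary error function. The function $f^{(0)}_{\hat R,\hat\theta}$ is $f^{(0)}_{\hat{\boldsymbol q}}$ multiplied by the absolute Jacobian determinant of the map $(R,\theta)\mapsto(q_{\mathrm d},q_{\mathrm o})$. The asymptotic regime is $N\to\infty$ and $|\mathcal D|\to\infty$ with both ratios of domain length to correlation length tending to infinity. *)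

(* Defs.v *)
From HB Require Import structures.
From mathcomp Require Import all_boot all_order all_algebra.
From mathcomp Require Import all_classical all_reals all_analysis.
From mathcomp.real_closed Require Import complex.

Set Implicit Arguments.
Unset Strict Implicit.
Unset Printing Implicit Defensive.

Import Order.TTheory GRing.Theory Num.Theory.
Import numFieldNormedType.Exports.

Local Open Scope classical_set_scope.
Local Open Scope ring_scope.

Section plane.
Context {R : realType}.

Definition dotp (p q : R * R) : R := p.1 * q.1 + p.2 * q.2.

(* The library norm on R * R is the sup norm. *)
Definition enorm (p : R * R) : R := Num.sqrt (p.1 ^+ 2 + p.2 ^+ 2).

Definition axis (i : 'I_2) : R * R := if i == 0 then (1, 0) else (0, 1).

Definition area := (@lebesgue_measure R \x @lebesgue_measure R)%E.

Definition short_ranged (c : R * R -> R) :=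
  area.-integrable [set: R * R] (EFin \o c).

(* \int c(r) exp(- i k.r) dr *)
Definition fourier (c : R * R -> R) (k : R * R) : R[i] :=
  Complex (\int[area]_r (c r * cos (dotp k r)))
          (- \int[area]_r (c r * sin (dotp k r))).

(* In R[i], z <= x%:C means that z is real and at most x. *)
Definition spectral_decay (c : R * R -> R) :=
  exists eps Cinf K : R, [/\ 0 < eps, 0 < Cinf &
    forall k, K <= enorm k ->
      fourier c k <= (Cinf / enorm k `^ (3 + eps))%:C%C].

End plane.

Section random_field.
Context d (T : measurableType d) (R : realType) (P : probability T R).

(* [normal_prob m 0] is not a point mass, hence the separate degenerate case. *)
Definition gaussian (Y : T -> R) :=
  exists m sigma : R, if sigma == 0 then {ae P, forall w, Y w = m}
    else forall A : set R, measurable A -> P (Y @^-1` A) = normal_prob m sigma A.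

Definition gaussian_field (D : set (R * R)) (X : R * R -> {RV P >-> R}) :=
  forall n (p : 'I_n -> R * R) (a : 'I_n -> R), (forall i, D (p i)) ->
    gaussian (fun w => \sum_(i < n) a i * X (p i) w).

Definition wide_sense_stationary (D : set (R * R)) (X : R * R -> {RV P >-> R})
    (m : R) (c : R * R -> R) :=
  (forall p, D p -> 'E_P[X p] = m%:E)%E /\
  (forall p q, D p -> D q -> covariance P (X p) (X q) = (c (p - q))%:E).

Definition ms_gradient (D : set (R * R)) (X : R * R -> {RV P >-> R})
    (dX : 'I_2 -> R * R -> {RV P >-> R}) :=
  forall i p, D p ->
    'E_P[(fun w => ((X (p + h *: axis i) w - X p w) / h - dX i p w) ^+ 2)%R]%E
      @[h --> 0^'] --> 0%E.

Definition gradient_covariance (D : set (R * R))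
    (dX : 'I_2 -> R * R -> {RV P >-> R}) (Q : 'M[R]_2) :=
  forall p, D p -> forall i j,
    'E_P[(fun w => dX i p w * dX j p w)%R]%E = (Q i j)%:E.

Definition sample_Q (dX : 'I_2 -> R * R -> {RV P >-> R}) (N : nat)
    (s : 'I_N -> R * R) (w : T) : 'M[R]_2 :=
  \matrix_(i, j) (N%:R^-1 * \sum_(k < N) dX i (s k) w * dX j (s k) w).

End random_field.

Section anisotropy.
Context {R : realType}.

Definition qd (r theta : R) : R :=
  (1 + r ^+ 2 * tan theta ^+ 2) / (r ^+ 2 + tan theta ^+ 2).

Definition qo (r theta : R) : R :=
  tan theta * (r ^+ 2 - 1) / (r ^+ 2 + tan theta ^+ 2).

Definition anisotropy_range (r theta : R) :=
  0 < r /\ - (pi / 4) <= theta < pi / 4.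

(* Since x / 0 = 0 and [qd r theta] is positive in range, the first relation
   forces Q 0 0 to be nonzero. *)
Definition anisotropy_relations (Q : 'M[R]_2) (r theta : R) :=
  Q 1 1 / Q 0 0 = qd r theta /\ Q 0 1 / Q 0 0 = qo r theta.

(* The relations are solvable exactly when the sample matrix is positive
   definite (for instance, not when N = 1). *)
Definition anisotropy_statistics d (T : measurableType d) (P : probability T R)
    (dX : 'I_2 -> R * R -> {RV P >-> R}) (N : nat) (s : 'I_N -> R * R)
    (rhat thetahat : {RV P >-> R}) :=
  forall w, let Qhat := sample_Q dX s w in
    0 < Qhat 0 0 -> 0 < \det Qhat ->
    anisotropy_range (rhat w) (thetahat w) /\
    anisotropy_relations Qhat (rhat w) (thetahat w).

(* The domain D N used with N samples contains a rectangle whose side lengths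
   become infinitely large compared with the correlation lengths. *)
Definition asymptotic_regime (D : nat -> set (R * R)) (xi1 xi2 : R) :=
  exists (a : nat -> R * R) (L1 L2 : nat -> R),
    [/\ forall N, `[(a N).1, (a N).1 + L1 N] `*` `[(a N).2, (a N).2 + L2 N]
          `<=` D N,
        L1 N / xi1 @[N --> \oo] --> +oo &
        L2 N / xi2 @[N --> \oo] --> +oo].

End anisotropy.

Section density.
Context {R : realType}.

Definition erfc (x : R) : R :=
  2 / Num.sqrt pi * \int[lebesgue_measure]_(t in `[x, +oo[) expR (- t ^+ 2).

Definition vec3 (a b c : R) : 'cV[R]_3 := \col_(i < 3) [:: a; b; c]`_i.

Definition mat3 (u v w : seq R) : 'M[R]_3 :=
  \matrix_(i < 3, j < 3) (nth [::] [:: u; v; w] i)`_j.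

(* Density at (q 1 / q 0, q 2 / q 0), with q 0 = 1, of the ratios
   (Y 1 / Y 0, Y 2 / Y 0) of a Gaussian vector Y with mean mu and covariance
   matrix C, restricted to Y 0 > 0: the closed form of
   \int_(y > 0) y^2 g(y *: q) dy where g is the density of Y. *)
Definition ratio_density (mu : 'cV[R]_3) (C : 'M[R]_3) (q : 'cV[R]_3) : R :=
  let form (u v : 'cV[R]_3) := (u^T *m invmx C *m v) 0 0 in
  let z1 := Num.sqrt (form q q) in
  let z2 := - 2 * form mu q in
  let lambda1 := form mu mu in
  let lambda2 := (2 * pi) `^ (- (3 / 2)) * (\det C) `^ (- (1 / 2)) in
  lambda2 * expR (- lambda1 / 2) / (8 * z1 ^+ 5) *
  (Num.sqrt (2 * pi) * (z2 ^+ 2 + 4 * z1 ^+ 2)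
     * expR (z2 ^+ 2 / (8 * z1 ^+ 2)) * erfc (z2 / (2 * Num.sqrt 2 * z1))
   - 4 * z1 * z2).

Definition C0 (Q : 'M[R]_2) (N : nat) : 'M[R]_3 :=
  let Q11 := Q 0 0 in let Q22 := Q 1 1 in let Q12 := Q 0 1 in
  (2 / N%:R) *: mat3
    [:: Q11 ^+ 2;  Q12 ^+ 2;  Q11 * Q12]
    [:: Q12 ^+ 2;  Q22 ^+ 2;  Q12 * Q22]
    [:: Q11 * Q12; Q12 * Q22; (Q12 ^+ 2 + Q11 * Q22) / 2].

Definition f0_q (Q : 'M[R]_2) (N : nat) (r theta : R) : R :=
  ratio_density (vec3 (Q 0 0) (Q 1 1) (Q 0 1)) (C0 Q N)
    (vec3 1 (qd r theta) (qo r theta)).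

Definition jacobian_q (r theta : R) : R :=
  derive1 (qd^~ theta) r * derive1 (qo r) theta
  - derive1 (qd r) theta * derive1 (qo^~ theta) r.

Definition f0_RT (Q : 'M[R]_2) (N : nat) (r theta : R) : R :=
  f0_q Q N r theta * `|jacobian_q r theta|.

Definition z10 (r theta rs thetas : R) : R :=
  let dtheta := theta - thetas in
  Num.sqrt
   ((r ^+ 2 - 1) ^+ 2 * (rs ^+ 2 - 1) ^+ 2 * cos (4 * dtheta)
    - 4 * (r ^+ 4 - 1) * (rs ^+ 4 - 1) * cos (2 * dtheta)
    + (r ^+ 4 + 1) * (3 * rs ^+ 4 + 2 * rs ^+ 2 + 3)
    + 2 * r ^+ 2 * (rs ^+ 2 - 1) ^+ 2).

Definition y0 (r theta rs thetas : R) : R :=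
  let dtheta := theta - thetas in
  (Num.sqrt 2 * z10 r theta rs thetas)^-1 *
  ((r ^+ 2 - 1) * (rs ^+ 2 - 1) * cos (2 * dtheta)
   - (r ^+ 2 + 1) * (rs ^+ 2 + 1)).

Definition lambda20 (r theta rs : R) : R :=
  Num.sqrt 2 * rs ^+ 3 / pi `^ (3 / 2) *
  ((r ^+ 2 + 1) + (r ^+ 2 - 1) * cos (2 * theta)) ^+ 3.

Definition leading_f0_q (r theta rs thetas : R) (N : nat) : R :=
  let y := y0 r theta rs thetas in
  Num.sqrt (2 * pi) * lambda20 r theta rs / z10 r theta rs thetas ^+ 3 *
  (2 * y ^+ 2 * N%:R + 1) * expR (N%:R * (y ^+ 2 - 1 / 2)).

End density.

(* Main.v *)
Require Import Defs.
From HB Require Import structures.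
From mathcomp Require Import all_boot all_order all_algebra.
From mathcomp Require Import all_classical all_reals all_analysis.
From mathcomp Require Import measurable_realfun ring lra.
Import Order.TTheory GRing.Theory Num.Theory.
Import numFieldNormedType.Exports.
Local Open Scope classical_set_scope.
Local Open Scope ring_scope.

(** The anisotropy relations say that the gradient covariance [Q] is a positive
multiple of the shape matrix K* obtained by conjugating diag(R*^2, 1) with the
rotation of angle theta*; likewise the symmetric matrix with entries 1, [qd],
[qo] is K / K_11, with K built from (R, theta) in the same way.

The matrix C^(0) is the covariance of the empirical second moments of N
independent centred Gaussian vectors of covariance Q, so by Isserlis' formula
its inverse is the quadratic form (U, V) |-> N/2 tr(Q^-1 U Q^-1 V) on symmetric
2 x 2 matrices ([form_C0]).  Hence lambda_1 = N, while z_1 and z_2 depend only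
on det K = R^2, det K* = R*^2 and T = tr(adj(K* ) K), an affine function of
cos (2 (theta - theta* )) ([mixed_discrE]).  In particular
z_1 = sqrt N z_{1;0} / (4 a R*^2 K_11), where Q = a K*, and the argument
w = z_2 / (2 sqrt 2 z_1) of erfc is exactly sqrt N y_0.

Expressed through w, the density is its prefactor times (2 w^2 + 1) e^(w^2)
times [tail_factor w] ([ratio_densityE]), so for every N >= 1
f^(0)_q = leading term * tail_factor (sqrt N y_0)   ([f0_q_leading]).
Since T > 0, y_0 is negative and the argument tends to -oo, where erfc tends
to 2 and the remaining term is dominated by a Gaussian: the factor tends to 1
([cvg_tail_factor]).

The identity for the density of (R, theta) is the computation of the Jacobian
determinant, rational in R and tan theta ([jacobian_qE]). *)

(** * Shape matrices *)

Section shape.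
Context {R : realType}.
Implicit Types r theta rs thetas : R.

(** Entries of the conjugate of diag(r^2, 1) by the rotation of angle theta. *)
Definition shape11 r theta := r ^+ 2 * cos theta ^+ 2 + sin theta ^+ 2.
Definition shape22 r theta := cos theta ^+ 2 + r ^+ 2 * sin theta ^+ 2.
Definition shape12 r theta := cos theta * sin theta * (r ^+ 2 - 1).

Lemma sin2E theta : sin theta ^+ 2 = 1 - cos theta ^+ 2.
Proof. by have := cos2Dsin2 theta; lra. Qed.

Lemma shape11_gt0 r theta : 0 < r -> 0 < shape11 r theta.
Proof.
move=> r0; rewrite /shape11 sin2E.
have c0 := sqr_ge0 (cos theta).
have c1 : cos theta ^+ 2 <= 1.
  by have := sqr_ge0 (sin theta); rewrite sin2E subr_ge0.
have r20 : 0 < r ^+ 2 by rewrite exprn_gt0.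
have [->|cn0] := eqVneq (cos theta ^+ 2) 0; first by rewrite mulr0; lra.
by rewrite ltr_wpDr ?subr_ge0// mulr_gt0// lt_def cn0.
Qed.

Lemma det_shape r theta :
  shape11 r theta * shape22 r theta - shape12 r theta ^+ 2 = r ^+ 2.
Proof. by rewrite /shape11 /shape22 /shape12 !exprMn sin2E; ring. Qed.

Lemma anisotropy_range_cos_gt0 r theta :
  anisotropy_range r theta -> 0 < cos theta.
Proof.
move=> [_ /andP[h1 h2]]; have := @pi_gt0 R => pi0.
by apply: cos_gt0_pihalf; apply/andP; split; lra.
Qed.

Lemma qdE r theta : 0 < r -> cos theta != 0 ->
  qd r theta = shape22 r theta / shape11 r theta.
Proof.
move=> r0 c0; have := shape11_gt0 r theta r0.
rewrite /qd /tan /shape11 /shape22 => h.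
by field; rewrite c0 /= exprMn gt_eqF.
Qed.

Lemma qd_gt0 r theta : 0 < r -> 0 < qd r theta.
Proof.
move=> r0; have r20 : 0 < r ^+ 2 by rewrite exprn_gt0.
rewrite /qd divr_gt0//; last by rewrite ltr_wpDr// sqr_ge0.
by rewrite ltr_wpDr// mulr_ge0 ?sqr_ge0.
Qed.

Lemma qoE r theta : 0 < r -> cos theta != 0 ->
  qo r theta = shape12 r theta / shape11 r theta.
Proof.
move=> r0 c0; have := shape11_gt0 r theta r0.
rewrite /qo /tan /shape11 /shape12 => h.
by field; rewrite c0 /= exprMn gt_eqF.
Qed.

(** The trace of adj(K* ) K, that is, the polarization of twice the determinant
on symmetric 2 x 2 matrices. *)
Definition mixed_discr r theta rs thetas : R :=
  shape22 rs thetas * shape11 r theta + shape11 rs thetas * shape22 r theta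
  - 2 * shape12 rs thetas * shape12 r theta.

(** Each shape matrix is (r^2 + 1)/2 plus (r^2 - 1)/2 times a reflection, and
the trace of a product of two reflections is twice the cosine of the angle
between them. *)
Lemma mixed_discrE r theta rs thetas : mixed_discr r theta rs thetas =
  ((r ^+ 2 + 1) * (rs ^+ 2 + 1)
   - (r ^+ 2 - 1) * (rs ^+ 2 - 1) * cos (2 * (theta - thetas))) / 2.
Proof.
rewrite mulr_natl cos_mulr2n cosB /mixed_discr /shape11 /shape22 /shape12.
rewrite [in RHS]sqrrD !exprMn !sin2E; by field.
Qed.

(** T is affine in the cosine, so it suffices to check the values r^2 + rs^2 and
(r rs)^2 + 1 at +-1, which are bounded by the inequality of arithmetic and
geometric means. *)
Lemma mixed_discr_ge r theta rs thetas :
  2 * (r * rs) <= mixed_discr r theta rs thetas.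
Proof.
rewrite mixed_discrE; have := cos_le1 (2 * (theta - thetas)).
have := cos_geN1 (2 * (theta - thetas)); set c := cos _ => c1 c2.
have : 0 <= (1 + c) * (r - rs) ^+ 2 by rewrite mulr_ge0 ?sqr_ge0//; lra.
have : 0 <= (1 - c) * (r * rs - 1) ^+ 2 by rewrite mulr_ge0 ?sqr_ge0//; lra.
nra.
Qed.

Lemma mixed_discr_gt0 r theta rs thetas : 0 < r -> 0 < rs ->
  0 < mixed_discr r theta rs thetas.
Proof.
move=> r0 rs0; apply: lt_le_trans (mixed_discr_ge r theta rs thetas).
by rewrite !mulr_gt0.
Qed.

(** By Cayley-Hamilton, T^2 - 2 (r rs)^2 is the trace of (adj(K* ) K)^2. *)
Lemma z10E r theta rs thetas : z10 r theta rs thetas =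
  Num.sqrt (8 * (mixed_discr r theta rs thetas ^+ 2 - 2 * (r * rs) ^+ 2)).
Proof.
rewrite /z10 mixed_discrE; congr Num.sqrt.
have -> : 4 * (theta - thetas) = (2 * (theta - thetas)) *+ 2.
  by rewrite -mulr_natl; ring.
by rewrite cos_mulr2n; by field.
Qed.

Lemma z10_radicand_gt0 r theta rs thetas : 0 < r -> 0 < rs ->
  0 < mixed_discr r theta rs thetas ^+ 2 - 2 * (r * rs) ^+ 2.
Proof.
move=> r0 rs0; have := mixed_discr_ge r theta rs thetas.
have : 0 < r * rs by rewrite mulr_gt0.
by set x := r * rs; set T := mixed_discr _ _ _ _; nra.
Qed.

Lemma z10_gt0 r theta rs thetas : 0 < r -> 0 < rs ->
  0 < z10 r theta rs thetas.
Proof.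
by move=> r0 rs0; rewrite z10E sqrtr_gt0 mulr_gt0// z10_radicand_gt0.
Qed.

Lemma y0E r theta rs thetas : y0 r theta rs thetas =
  - (2 * mixed_discr r theta rs thetas / (Num.sqrt 2 * z10 r theta rs thetas)).
Proof. by rewrite /y0 mixed_discrE; set a := cos _; set b := _^-1; field. Qed.

Lemma y0_lt0 r theta rs thetas : 0 < r -> 0 < rs -> y0 r theta rs thetas < 0.
Proof.
move=> r0 rs0; rewrite y0E oppr_lt0 divr_gt0//.
  by rewrite mulr_gt0// mixed_discr_gt0.
by apply: mulr_gt0; [rewrite sqrtr_gt0|exact: z10_gt0].
Qed.

Lemma lambda20E r theta rs : lambda20 r theta rs =
  8 * Num.sqrt 2 * (rs * shape11 r theta / Num.sqrt pi) ^+ 3.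
Proof.
have p0 := @pi_gt0 R.
rewrite /lambda20 [3 / 2]mulrC powRrM powR12_sqrt ?ltW//.
rewrite powR_mulrn ?sqrtr_ge0//.
have -> : (r ^+ 2 + 1) + (r ^+ 2 - 1) * cos (2 * theta) = 2 * shape11 r theta.
  by rewrite mulr_natl cos_mulr2n /shape11 sin2E; ring.
by field; rewrite gt_eqF ?sqrtr_gt0.
Qed.

Lemma lambda20_gt0 r theta rs : 0 < r -> 0 < rs -> 0 < lambda20 r theta rs.
Proof.
move=> r0 rs0; rewrite lambda20E; apply: mulr_gt0.
  by rewrite mulr_gt0// sqrtr_gt0.
rewrite exprn_gt0// divr_gt0//; last by rewrite sqrtr_gt0 pi_gt0.
by rewrite mulr_gt0// shape11_gt0.
Qed.

Lemma leading_f0_q_gt0 r theta rs thetas N : 0 < r -> 0 < rs ->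
  0 < leading_f0_q r theta rs thetas N.
Proof.
move=> r0 rs0; apply: mulr_gt0; last exact: expR_gt0.
apply: mulr_gt0; first apply: divr_gt0.
- apply: mulr_gt0; last exact: lambda20_gt0.
  by rewrite sqrtr_gt0 mulr_gt0 ?pi_gt0.
- by rewrite exprn_gt0// z10_gt0.
- by rewrite ltr_wpDl// mulr_ge0// mulr_ge0 ?sqr_ge0.
Qed.

Lemma anisotropy_relations_shape (Q : 'M[R]_2) rs thetas : 0 < Q 0 0 ->
  anisotropy_range rs thetas -> anisotropy_relations Q rs thetas ->
  exists2 a : R, 0 < a & [/\ Q 0 0 = a * shape11 rs thetas,
    Q 1 1 = a * shape22 rs thetas & Q 0 1 = a * shape12 rs thetas].
Proof.
move=> Q0 hs [Q1 Q2]; have rs0 := hs.1.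
have c0 := anisotropy_range_cos_gt0 rs thetas hs.
have l0 := shape11_gt0 rs thetas rs0.
rewrite qdE ?gt_eqF// in Q1; rewrite qoE ?gt_eqF// in Q2.
exists (Q 0 0 / shape11 rs thetas); first exact: divr_gt0.
split; first by rewrite mulfVK// gt_eqF.
  by rewrite mulrAC -mulrA -Q1 mulrC mulfVK// gt_eqF.
by rewrite mulrAC -mulrA -Q2 mulrC mulfVK// gt_eqF.
Qed.

End shape.

(** * The approximate covariance matrix *)

Section covariance.
Context {R : realType}.

Lemma det_C0 (Q : 'M[R]_2) N : (0 < N)%N ->
  \det (C0 Q N) = 4 * (Q 0 0 * Q 1 1 - Q 0 1 ^+ 2) ^+ 3 / N%:R ^+ 3.
Proof.
move=> N0; have N0' : N%:R != 0 :> R by rewrite pnatr_eq0 -lt0n.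
rewrite /C0 detZ (expand_det_row _ 0) !big_ord_recl big_ord0 /cofactor.
rewrite !(expand_det_row _ 0) !big_ord_recl !big_ord0 /cofactor.
rewrite !det_mx11 !mxE /= /bump /= !expr0 !expr1.
by set a := Q 0 0; set b := Q 1 1; set c := Q 0 1; field.
Qed.

(** The form N/2 tr(Q^-1 U Q^-1 V), where u and v list the entries (1,1), (2,2),
(1,2) of U and V, written with Q^-1 = adj Q / D by polarizing the identity
tr(A^2) = (tr A)^2 - 2 det A for A = adj(Q) U; here tau is U |-> tr(adj(Q) U). *)
Lemma form_C0 (Q : 'M[R]_2) N (u1 u2 u3 v1 v2 v3 : R) : (0 < N)%N ->
  let D := Q 0 0 * Q 1 1 - Q 0 1 ^+ 2 in
  let tau a b c := Q 1 1 * a + Q 0 0 * b - 2 * Q 0 1 * c in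
  D != 0 ->
  ((vec3 u1 u2 u3)^T *m invmx (C0 Q N) *m vec3 v1 v2 v3) 0 0 =
  N%:R / (2 * D ^+ 2) *
    (tau u1 u2 u3 * tau v1 v2 v3 - D * (u1 * v2 + u2 * v1 - 2 * u3 * v3)).
Proof.
move=> N0 D tau D0.
have N0' : N%:R != 0 :> R by rewrite pnatr_eq0 -lt0n.
pose a := Q 0 0; pose b := Q 1 1; pose c := Q 0 1.
pose Ci := (N%:R / (2 * D ^+ 2)) *: mat3
  [:: b ^+ 2;        c ^+ 2;        - 2 * (b * c)]
  [:: c ^+ 2;        a ^+ 2;        - 2 * (a * c)]
  [:: - 2 * (b * c); - 2 * (a * c); 2 * (a * b + c ^+ 2)].
have CiK : C0 Q N *m Ci = 1%:M.
  rewrite /C0 /Ci -scalemxAr -scalemxAl scalerA.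
  apply/matrixP => -[[|[|[|//]]] hi] [[|[|[|//]]] hj];
    rewrite !mxE !big_ord_recl big_ord0 !mxE /= ?mulr1n ?mulr0n -/a -/b -/c;
    rewrite /D -/a -/b -/c in D0 *; by field; rewrite D0 N0'.
have [Cu _] := mulmx1_unit CiK.
have -> : invmx (C0 Q N) = Ci by rewrite -[RHS](mulKmx Cu) CiK mulmx1.
rewrite -scalemxAr -scalemxAl !mxE !big_ord_recl big_ord0 !mxE.
rewrite !big_ord_recl !big_ord0 !mxE /= /tau /D -/a -/b -/c.
by congr (_ * _); ring.
Qed.

End covariance.

(** * The ratio density for large negative arguments *)

Section tail.
Context {R : realType}.

(** The ratio of the density to its leading term, as a function of the argument
w of erfc. *)
Definition tail_factor (w : R) : R :=
  erfc w / 2 - w * expR (- w ^+ 2) / (Num.sqrt pi * (2 * w ^+ 2 + 1)).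

Lemma twice_sqrD1_gt0 (w : R) : 0 < 2 * w ^+ 2 + 1.
Proof. by rewrite ltr_wpDl// mulr_ge0// sqr_ge0. Qed.

(** The substitution z_2 = 2 sqrt 2 z_1 w (with z_1 = f) turns z_2^2 + 4 z_1^2
into 4 z_1^2 (2 w^2 + 1) and z_2^2 / (8 z_1^2) into w^2. *)
Lemma ratio_densityE (mu q : 'cV[R]_3) (C : 'M[R]_3) (f : R) :
  let form (u v : 'cV[R]_3) := (u^T *m invmx C *m v) 0 0 in
  let w := - (form mu q / (Num.sqrt 2 * f)) in
  f ^+ 2 = form q q -> 0 < f ->
  ratio_density mu C q =
  (2 * pi) `^ (- (3 / 2)) * (\det C) `^ (- (1 / 2)) / f ^+ 3
  * Num.sqrt (2 * pi) * (2 * w ^+ 2 + 1) * expR (w ^+ 2 - form mu mu / 2)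
  * tail_factor w.
Proof.
move=> form w ff f0.
rewrite /ratio_density -/(form q q) -/(form mu q) -/(form mu mu) -ff.
rewrite sqrtr_sqr gtr0_norm// /tail_factor.
have s2 : Num.sqrt 2 ^+ 2 = 2 :> R by rewrite sqr_sqrtr.
have s20 : 0 < Num.sqrt 2 :> R by rewrite sqrtr_gt0.
have sp0 : 0 < Num.sqrt pi :> R by rewrite sqrtr_gt0 pi_gt0.
have -> : - 2 * form mu q / (2 * Num.sqrt 2 * f) = w.
  by rewrite /w; field; rewrite !gt_eqF.
have z2E : - 2 * form mu q = 2 * (Num.sqrt 2 * (w * f)).
  by rewrite /w; field; rewrite !gt_eqF.
have z22E : (- 2 * form mu q) ^+ 2 = 8 * (w ^+ 2 * f ^+ 2).
  by rewrite z2E !exprMn s2; ring.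
rewrite z22E.
have -> : 8 * (w ^+ 2 * f ^+ 2) / (8 * f ^+ 2) = w ^+ 2.
  by field; rewrite gt_eqF.
rewrite z2E expRD mulNr !expRN sqrtrM//.
have := twice_sqrD1_gt0 w; clearbody w => w1.
by field; rewrite !gt_eqF//= expR_gt0.
Qed.

(** Dominated convergence: along any sequence tending to -oo the Gaussian cut
off below the n-th term tends pointwise to the whole Gaussian. *)
Lemma cvg_erfc_Ny : erfc x @[x --> -oo] --> (2 : R).
Proof.
pose mu := @lebesgue_measure R.
apply/cvg_ninftyP => u uNy.
have mg := @measurable_gauss_fun R.
pose f_ n x := ((gauss_fun \_ `[u n, +oo[) x)%:E.
have mf_ n : measurable_fun setT (f_ n).
  apply/measurable_EFinP/(measurable_restrictT _ _).1 => //.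
  exact: measurable_funTS.
have f_cvg x : f_ n x @[n --> \oo] --> (gauss_fun x)%:E.
  apply: cvg_near_cst; near=> n.
  rewrite /f_ patchE mem_set//= in_itv/= andbT; near: n.
  exact: cvgrNy_le.
have f_le n x : (`|f_ n x| <= (gauss_fun x)%:E)%E.
  rewrite /f_ lee_fin patchE; case: ifP => _.
    by rewrite ger0_norm// gauss_fun_ge0.
  by rewrite normr0 gauss_fun_ge0.
have [_ _] := @dominated_convergence _ _ R mu _ measurableT _ _ _ mf_
  ((measurable_EFinP _ _).2 mg) (aeW mu (fun x _ => f_cvg x))
  integrableT_gauss (aeW mu (fun x n _ => f_le n x)).
rewrite integralT_gauss => /fine_cvgP[_].
rewrite /erfc /=; set k := 2 / _ => cvgI.
have -> : (2 : R) = k * Num.sqrt pi.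
  by rewrite /k mulfVK// gt_eqF// sqrtr_gt0 pi_gt0.
apply: cvgM; first exact: cvg_cst.
apply: cvg_trans cvgI; apply: near_eq_cvg; apply: nearW => n /=.
by rewrite Rintegral_mkcond.
Unshelve. all: by end_near. Qed.

Lemma cvg_gauss_fun_Ny : gauss_fun x @[x --> -oo] --> (0 : R).
Proof.
apply/cvgNy_compNP.
rewrite (_ : gauss_fun \o -%R = gauss_fun); first exact: cvg_gauss_fun.
by apply/funext => x /=; rewrite /gauss_fun sqrrN.
Qed.

Lemma cvg_tail_factor : tail_factor w @[w --> -oo] --> (1 : R).
Proof.
rewrite [X in _ --> X](_ : 1 = 2 / 2 - 0); last by rewrite divff// subr0.
apply: cvgB; first exact: (cvgM cvg_erfc_Ny (cvg_cst _)).
have sp : 0 < Num.sqrt pi :> R by rewrite sqrtr_gt0 pi_gt0.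
have cg : gauss_fun w / Num.sqrt pi @[w --> -oo] --> (0 : R).
  rewrite -(mul0r (Num.sqrt pi)^-1).
  exact: (cvgM cvg_gauss_fun_Ny (cvg_cst _)).
apply/norm_cvg0P.
apply: (@squeeze_cvgr _ _ _ _ (cst 0) (fun w => gauss_fun w / Num.sqrt pi)) => //;
  last exact: cvg_cst.
apply: nearW => w; rewrite normr_ge0 /=.
have q0 := twice_sqrD1_gt0 w.
rewrite !normrM normfV normrM (ger0_norm (expR_ge0 _)) (gtr0_norm sp).
rewrite (gtr0_norm q0) /gauss_fun [leLHS](_ : _ =
    `|w| / (2 * w ^+ 2 + 1) * (expR (- w ^+ 2) / Num.sqrt pi)); last first.
  by field; rewrite !gt_eqF.
rewrite ler_piMl ?divr_ge0 ?expR_ge0 ?(ltW sp)// ler_pdivrMr// mul1r.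
by rewrite -(real_normK (num_real w)); nra.
Qed.

Lemma cvg_sqrt_mul_Ny (y : R) : y < 0 -> Num.sqrt n%:R * y @[n --> \oo] --> -oo.
Proof.
move=> y0; apply/cvgrNyPle => A; near=> n.
rewrite -ler_ndivrMr// (le_trans (ler_norm _))// -sqrtr_sqr ler_wsqrtr//.
by near: n; exact: nbhs_infty_ger.
Unshelve. all: by end_near. Qed.

End tail.

(** * The approximate density and its leading term *)

Section leading.
Context {R : realType}.
Implicit Types r theta rs thetas : R.

(** The powers of N and of the scale a, for det Q = (a rs)^2, cancel between
[det C0] and z_1^3. *)
Lemma prefactorE (Q : 'M[R]_2) N a rs r theta z : (0 < N)%N ->
  0 < a -> 0 < rs -> 0 < r -> 0 < z ->
  Q 0 0 * Q 1 1 - Q 0 1 ^+ 2 = (a * rs) ^+ 2 ->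
  (2 * pi) `^ (- (3 / 2)) * (\det (C0 Q N)) `^ (- (1 / 2))
    / (Num.sqrt N%:R * z / (4 * a * rs ^+ 2 * shape11 r theta)) ^+ 3 =
  lambda20 r theta rs / z ^+ 3.
Proof.
move=> N0 a0 rs0 r0 z0 D; have l0 := shape11_gt0 r theta r0.
have Nr : 0 < N%:R :> R by rewrite ltr0n.
have s2 : Num.sqrt 2 ^+ 2 = 2 :> R by rewrite sqr_sqrtr.
have s20 : 0 < Num.sqrt 2 :> R by rewrite sqrtr_gt0.
have sp0 : 0 < Num.sqrt pi :> R by rewrite sqrtr_gt0 pi_gt0.
pose sN : R := Num.sqrt N%:R; have sN0 : 0 < sN by rewrite sqrtr_gt0.
have sNN : sN ^+ 2 = N%:R by rewrite sqr_sqrtr// ltW.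
have dC : \det (C0 Q N) = (2 * (a * rs) ^+ 3 / sN ^+ 3) ^+ 2.
  by rewrite det_C0// D -sNN; field; rewrite gt_eqF.
have g0 : 0 < 2 * (a * rs) ^+ 3 / sN ^+ 3.
  by apply: divr_gt0; rewrite ?exprn_gt0// mulr_gt0// exprn_gt0// mulr_gt0.
rewrite dC -/sN !powRN div1r powR12_sqrt ?exprn_ge0 ?(ltW g0)//.
rewrite sqrtr_sqr gtr0_norm//.
rewrite [3 / 2]mulrC powRrM powR12_sqrt ?mulr_ge0 ?pi_ge0//.
rewrite powR_mulrn ?sqrtr_ge0// sqrtrM// lambda20E.
have -> : (Num.sqrt 2 * Num.sqrt pi) ^+ 3
    = 2 * Num.sqrt 2 * Num.sqrt pi ^+ 3 :> R.
  by rewrite exprMn exprS s2; ring.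
have -> : 8 * Num.sqrt 2 = 16 / Num.sqrt 2 :> R.
  apply: (mulIf (lt0r_neq0 s20)).
  by rewrite divfK ?gt_eqF// -mulrA -expr2 s2; ring.
by field; rewrite !gt_eqF.
Qed.

Lemma f0_q_leading (Q : 'M[R]_2) N r theta rs thetas : (0 < N)%N ->
  0 < Q 0 0 -> anisotropy_relations Q rs thetas ->
  anisotropy_range rs thetas -> anisotropy_range r theta ->
  f0_q Q N r theta = leading_f0_q r theta rs thetas N *
    tail_factor (Num.sqrt N%:R * y0 r theta rs thetas).
Proof.
move=> N0 Q0 hQ hs h.
have [a a0 [e0 e1 e2]] := anisotropy_relations_shape Q rs thetas Q0 hs hQ.
have [[rs0 _] [r0 _]] := (hs, h).
have c0 := anisotropy_range_cos_gt0 r theta h.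
have l0 := shape11_gt0 r theta r0; have ls0 := shape11_gt0 rs thetas rs0.
have D : Q 0 0 * Q 1 1 - Q 0 1 ^+ 2 = (a * rs) ^+ 2.
  by rewrite exprMn -(det_shape rs thetas) e0 e1 e2; ring.
have D0 : Q 0 0 * Q 1 1 - Q 0 1 ^+ 2 != 0.
  by rewrite D expf_neq0// mulf_neq0 ?gt_eqF.
have Nr : 0 < N%:R :> R by rewrite ltr0n.
pose T := mixed_discr r theta rs thetas.
pose z := z10 r theta rs thetas.
have z0 : 0 < z := z10_gt0 r theta rs thetas r0 rs0.
have zz : z ^+ 2 = 8 * (T ^+ 2 - 2 * (r * rs) ^+ 2).
  by rewrite /z z10E sqr_sqrtr// mulr_ge0// ltW// z10_radicand_gt0.
pose sN : R := Num.sqrt N%:R; have sN0 : 0 < sN by rewrite sqrtr_gt0.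
have sNN : sN ^+ 2 = N%:R by rewrite sqr_sqrtr// ltW.
pose mu := vec3 (Q 0 0) (Q 1 1) (Q 0 1).
pose q := vec3 1 (qd r theta) (qo r theta).
pose z1 := sN * z / (4 * a * rs ^+ 2 * shape11 r theta).
have z1_gt0 : 0 < z1.
  apply: divr_gt0; first exact: mulr_gt0.
  by apply: mulr_gt0 => //; apply: mulr_gt0; [exact: mulr_gt0|exact: exprn_gt0].
have form_mu_mu : (mu^T *m invmx (C0 Q N) *m mu) 0 0 = N%:R.
  rewrite form_C0//; move: D0.
  by set x := Q 0 0; set y := Q 1 1; set t := Q 0 1 => D0; field.
have form_mu_q : (mu^T *m invmx (C0 Q N) *m q) 0 0 =
    N%:R * T / (2 * a * rs ^+ 2 * shape11 r theta).
  rewrite form_C0// qdE ?qoE ?gt_eqF//.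
  (* tau mu = 2 D, so one factor D cancels *)
  transitivity (N%:R / (2 * (Q 0 0 * Q 1 1 - Q 0 1 ^+ 2))
    * (Q 1 1 + Q 0 0 * (shape22 r theta / shape11 r theta)
       - 2 * Q 0 1 * (shape12 r theta / shape11 r theta))).
    move: D0; set x := Q 0 0; set y := Q 1 1; set t := Q 0 1 => D0.
    by field; rewrite D0 gt_eqF.
  by rewrite D e0 e1 e2 /T /mixed_discr; field; rewrite !gt_eqF.
have form_q_q : z1 ^+ 2 = (q^T *m invmx (C0 Q N) *m q) 0 0.
  rewrite form_C0// D qdE ?qoE ?gt_eqF//.
  rewrite /z1 !exprMn sNN zz exprMn -(det_shape r theta) e0 e1 e2.
  by rewrite /T /mixed_discr; field; rewrite !gt_eqF.
rewrite /f0_q -/mu -/q (ratio_densityE _ _ _ z1)// form_mu_mu form_mu_q.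
have wE : - (N%:R * T / (2 * a * rs ^+ 2 * shape11 r theta)
    / (Num.sqrt 2 * z1)) = sN * y0 r theta rs thetas.
  have s20 : 0 < Num.sqrt 2 :> R by rewrite sqrtr_gt0.
  by rewrite y0E -/T -/z /z1 -sNN; field; rewrite !gt_eqF.
rewrite wE; congr (_ * _).
rewrite /leading_f0_q (prefactorE Q N a rs r theta z)// -/z exprMn sNN.
set y := y0 _ _ _ _.
have -> : N%:R * y ^+ 2 - N%:R / 2 = N%:R * (y ^+ 2 - 1 / 2) by field.
by congr (_ * _); field; rewrite gt_eqF.
Qed.

End leading.

(** * The Jacobian determinant *)

Section jacobian.
Context {R : realType}.

(** With one of f, g constant and the other the identity or the tangent, this
gives both partial derivatives of [qd]; the next lemma does the same for
[qo]. *)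
Lemma is_derive_qd (f g : R -> R) (x df dg : R) :
  f x ^+ 2 + g x ^+ 2 != 0 -> is_derive x 1 f df -> is_derive x 1 g dg ->
  is_derive x 1 (fun y => (1 + f y ^+ 2 * g y ^+ 2) / (f y ^+ 2 + g y ^+ 2))
   ((2 * f x * (g x ^+ 4 - 1) * df + 2 * g x * (f x ^+ 4 - 1) * dg)
     / (f x ^+ 2 + g x ^+ 2) ^+ 2).
Proof.
move=> h hf hg.
have hn : is_derive x 1 (fun y => 1 + f y ^+ 2 * g y ^+ 2)
    (2 * f x * g x ^+ 2 * df + 2 * g x * f x ^+ 2 * dg).
  by apply: is_derive_eq; rewrite /GRing.scale /=; ring.
have hd : is_derive x 1 (fun y => f y ^+ 2 + g y ^+ 2)
    (2 * f x * df + 2 * g x * dg).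
  by apply: is_derive_eq; rewrite /GRing.scale /=; ring.
have hv := @is_deriveV _ (fun y => f y ^+ 2 + g y ^+ 2) _ _ _ h hd.
have hm := is_deriveM hn hv; apply: (is_derive_eq hm).
by rewrite /GRing.scale /=; field.
Qed.

Lemma is_derive_qo (f g : R -> R) (x df dg : R) :
  f x ^+ 2 + g x ^+ 2 != 0 -> is_derive x 1 f df -> is_derive x 1 g dg ->
  is_derive x 1 (fun y => g y * (f y ^+ 2 - 1) / (f y ^+ 2 + g y ^+ 2))
   ((2 * f x * g x * (g x ^+ 2 + 1) * df
      + (f x ^+ 2 - 1) * (f x ^+ 2 - g x ^+ 2) * dg)
     / (f x ^+ 2 + g x ^+ 2) ^+ 2).
Proof.
move=> h hf hg.
have hn : is_derive x 1 (fun y => g y * (f y ^+ 2 - 1))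
    (2 * f x * g x * df + (f x ^+ 2 - 1) * dg).
  by apply: is_derive_eq; rewrite /GRing.scale /=; ring.
have hd : is_derive x 1 (fun y => f y ^+ 2 + g y ^+ 2)
    (2 * f x * df + 2 * g x * dg).
  by apply: is_derive_eq; rewrite /GRing.scale /=; ring.
have hv := @is_deriveV _ (fun y => f y ^+ 2 + g y ^+ 2) _ _ _ h hd.
have hm := is_deriveM hn hv; apply: (is_derive_eq hm).
by rewrite /GRing.scale /=; field.
Qed.

Lemma is_derive_derive1 (f : R -> R) (x v : R) :
  is_derive x 1 f v -> derive1 f x = v.
Proof. by move=> h; rewrite derive1E derive_val. Qed.

Lemma jacobian_qE (r theta : R) : 0 < r -> cos theta != 0 ->
  jacobian_q r theta = - (2 * r * (r ^+ 2 - 1) / shape11 r theta ^+ 3).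
Proof.
move=> r0 c0; have l0 := shape11_gt0 r theta r0.
have h : r ^+ 2 + tan theta ^+ 2 != 0.
  by rewrite gt_eqF// ltr_wpDr ?sqr_ge0// exprn_gt0.
have did : is_derive r 1 (fun y : R => y) 1 by exact: is_derive_id.
have dcst a (x : R) : is_derive x 1 (fun=> a : R) 0 by exact: is_derive_cst.
have dtan := is_derive_tan c0.
rewrite /jacobian_q.
rewrite (is_derive_derive1 _ _ _ (is_derive_qd (fun y => y) (fun=> tan theta)
  r _ _ h did (dcst _ _))).
rewrite (is_derive_derive1 _ _ _ (is_derive_qo (fun y => y) (fun=> tan theta)
  r _ _ h did (dcst _ _))).
rewrite (is_derive_derive1 _ _ _ (is_derive_qd (fun=> r) tan
  theta _ _ h (dcst _ _) dtan)).
rewrite (is_derive_derive1 _ _ _ (is_derive_qo (fun=> r) tan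
  theta _ _ h (dcst _ _) dtan)).
have c2V : (cos theta)^-2 = 1 + tan theta ^+ 2.
  by rewrite expr_div_n sin2E; field.
have lE : shape11 r theta = (r ^+ 2 + tan theta ^+ 2) / (1 + tan theta ^+ 2).
  by rewrite -c2V invrK mulrDl expr_div_n divfK// expf_neq0.
have t0 : 1 + tan theta ^+ 2 != 0 by rewrite -c2V invr_eq0 expf_neq0.
rewrite c2V lE /=; set t := tan theta in h t0 *.
by field; rewrite h t0.
Qed.

End jacobian.

(** * The joint density of the anisotropy statistics *)

Lemma gradient_covariance_ge0 {R : realType} {d : measure_display}
    {T : measurableType d} {P : probability T R} {D : set (R * R)%type}
    {dX : 'I_2 -> (R * R)%type -> {RV P >-> R}} {Q : 'M[R]_2} {p} i :
  D p -> gradient_covariance D dX Q -> 0 <= Q i i.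
Proof.
move=> Dp hQ; rewrite -lee_fin -(hQ p Dp i i).
by apply: expectation_ge0 => w; rewrite -expr2 sqr_ge0.
Qed.

Theorem theorem4 (R : realType) (d : measure_display) (T : measurableType d)
    (P : probability T R)
    (D : nat -> set (R * R)%type) (X : (R * R)%type -> {RV P >-> R})
    (dX : 'I_2 -> (R * R)%type -> {RV P >-> R})
    (m : R) (c : (R * R)%type -> R) (Q : 'M[R]_2) (Rstar thetastar xi1 xi2 : R)
    (s : forall N : nat, 'I_N -> (R * R)%type)
    (Rhat thetahat : nat -> {RV P >-> R})
    (openD : forall N, open (D N))
    (X_gaussian : forall N, gaussian_field (D N) X)
    (X_stationary : forall N, wide_sense_stationary (D N) X m c)
    (X_differentiable : forall N, ms_gradient (D N) X dX)
    (c_short_ranged : short_ranged c)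
    (c_decay : spectral_decay c)
    (Q_def : forall N, gradient_covariance (D N) dX Q)
    (star_range : anisotropy_range Rstar thetastar)
    (star_def : anisotropy_relations Q Rstar thetastar)
    (xi1_gt0 : 0 < xi1) (xi2_gt0 : 0 < xi2) (Rstar_xi : Rstar = xi2 / xi1)
    (s_in_D : forall N k, D N (s N k))
    (hat_def : forall N, anisotropy_statistics dX (s N) (Rhat N) (thetahat N))
    (regime : asymptotic_regime D xi1 xi2) :
  forall r theta : R, anisotropy_range r theta ->
    (forall N : nat, (0 < N)%N ->
       f0_RT Q N r theta =
       2 * r * `|r ^+ 2 - 1|
         / (r ^+ 2 * cos theta ^+ 2 + sin theta ^+ 2) ^+ 3
         * f0_q Q N r theta) /\
    (f0_q Q N r theta / leading_f0_q r theta Rstar thetastar N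
       @[N --> \oo] --> (1 : R)).
Proof.
move=> r theta h; have [r0 _] := h; have [rs0 _] := star_range.
have c0 := anisotropy_range_cos_gt0 r theta h.
have Q0 : 0 < Q 0 0.
  rewrite lt_def (gradient_covariance_ge0 _ (s_in_D 1%N ord0) (Q_def 1%N)) andbT.
  (* were Q_11 zero, the first relation would read 0 = qd *)
  apply/eqP => Q00; have := qd_gt0 Rstar thetastar rs0.
  by rewrite -star_def.1 Q00 invr0 mulr0 ltxx.
split=> [N N0|].
  rewrite /f0_RT jacobian_qE ?gt_eqF// normrN normrM normfV.
  rewrite [`|2 * r * _|]normrM (gtr0_norm (mulr_gt0 _ r0))//.
  by rewrite (gtr0_norm (exprn_gt0 3 (shape11_gt0 r theta r0))) mulrC.
have cvg1 : tail_factor (Num.sqrt N%:R * y0 r theta Rstar thetastar)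
    @[N --> \oo] --> (1 : R).
  move/cvg_ninftyP : (@cvg_tail_factor R); apply.
  by apply: cvg_sqrt_mul_Ny; exact: y0_lt0.
apply: cvg_trans cvg1; apply: near_eq_cvg; near=> N.
rewrite (f0_q_leading _ _ _ _ Rstar thetastar)//; last first.
  by near: N; exact: nbhs_infty_gt.
by rewrite mulrAC divff ?mul1r// gt_eqF// leading_f0_q_gt0.
Unshelve. all: by end_near. Qed.
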